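(* Let $\mathcal{C}=\{A_1,\dots,A_L\}$ be a set of real symmetric $m\times m$ matrices, and let $S\in\operatorname{span}(\mathcal{C})$ be nonsingular. Suppose that $S^{-1}A_i$ has only real eigenvalues for all $1\le i\le L$, that $[A_i,A_j]_S=0$ for all $1\le i\ne j\le L$, and that there exists an index $i$ such that no two Jordan blocks in the Jordan normal form of $S^{-1}A_i$ have both the same eigenvalue and the same size. Then $\mathcal{C}$ is TWSD-B.
   Context: $\operatorname{span}(\mathcal{C})=\{\sum_{i=1}^L\alpha_iA_i:\alpha_i\in\mathbb{R}\}$. For symmetric $A,B,S\in\mathbb{R}^{m\times m}$ with $S$ nonsingular, $[A,B]_S=S^{-1}AS^{-1}B-S^{-1}BS^{-1}A$. $\mathrm{SL}_m(\mathbb{R})$ is the group of real $m\times m$ matrices with determinant $1$; $\|\cdot\|$ is the Frobenius norm. The set $\mathcal{C}$ is TWSD-B if there exist $P_k\in\mathrm{SL}_m(\mathbb{R})$ and diagonal matrices $D_k^{(1)},\dots,D_k^{(L)}\in\mathbb{R}^{m\times m}$ for $k\ge 1$ such that $\lim_{k\to\infty}\sum_{i=1}^L\|P_kA_iP_k^{\mathsf T}-D_k^{(i)}\|^2=0$ and $\|D_k^{(i)}\|$ is bounded uniformly in $i$ and $k$. *)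

(* Defs.v *)
From HB Require Import structures.
From mathcomp Require Import all_boot all_order all_algebra.
From mathcomp Require Import complex.
From mathcomp Require Import all_classical all_reals all_analysis.

Set Implicit Arguments.
Unset Strict Implicit.
Unset Printing Implicit Defensive.

Import Order.TTheory GRing.Theory Num.Theory.
Import numFieldNormedType.Exports.

Local Open Scope classical_set_scope.
Local Open Scope ring_scope.

Definition bracket (F : fieldType) (m : nat) (S A B : 'M[F]_m) : 'M[F]_m :=
  invmx S *m A *m invmx S *m B - invmx S *m B *m invmx S *m A.

(* [eigenvalue] only sees eigenvalues in the base field, hence the passage to
   complex scalars. *)
Definition only_real_eigenvalues (R : rcfType) (m : nat) (M : 'M[R]_m) : Prop :=
  forall z : complex R,
    eigenvalue (map_mx (real_complex R) M) z -> z \is Num.real.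

Definition jordan_block (F : fieldType) (n : nat) (a : F) : 'M[F]_n :=
  \matrix_(i < n, j < n) (a *+ (i == j) + (i.+1 == j :> nat)%:R).

Definition jordan_mx (F : fieldType) (r : nat) (lam : 'I_r -> F)
    (p : 'I_r -> nat) : 'M[F]_(\sum_k p k) :=
  \mxdiag_(k < r) jordan_block (p k) (lam k).

(* The Jordan matrix with blocks (lam k, p k) is a Jordan normal form of M. The
   cast along [e] only identifies the total size of the blocks with m. *)
Definition is_jordan_form (F : fieldType) (m : nat) (M : 'M[F]_m) (r : nat)
    (lam : 'I_r -> F) (p : 'I_r -> nat) : Prop :=
  (forall k, (0 < p k)%N) /\
  exists e : (\sum_k p k)%N = m,
    similar_in unitmx M (castmx (e, e) (jordan_mx lam p)).

(* A Jordan normal form is unique up to the order of its blocks, so it does not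
   matter which one is exhibited. *)
Definition jordan_blocks_distinct (F : fieldType) (m : nat) (M : 'M[F]_m) :
    Prop :=
  exists (r : nat) (lam : 'I_r -> F) (p : 'I_r -> nat),
    is_jordan_form M lam p /\
    forall k l : 'I_r, k != l -> ~ (lam k = lam l /\ p k = p l).

(* The norm `|M| that matrices carry in the library is the sup norm. *)
Definition frobenius_norm (R : rcfType) (m n : nat) (M : 'M[R]_(m, n)) : R :=
  Num.sqrt (\sum_(i < m) \sum_(j < n) M i j ^+ 2).

Definition twsd_b (R : realType) (m L : nat) (A : 'I_L -> 'M[R]_m) : Prop :=
  exists (P : nat -> 'M[R]_m) (D : nat -> 'I_L -> 'M[R]_m),
    [/\ forall k, \det (P k) = 1,
        forall k i, is_diag_mx (D k i),
        (fun k => \sum_(i < L)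
           frobenius_norm (P k *m A i *m (P k)^T - D k i) ^+ 2) @ \oo --> (0 : R)
      & exists B : R, forall k i, frobenius_norm (D k i) <= B].

(* Main.v *)
Require Import Defs.
From HB Require Import structures.
From mathcomp Require Import all_boot all_order all_algebra.
From mathcomp Require Import complex.
From mathcomp Require Import all_classical all_reals all_analysis.
From mathcomp Require Import zify ring lra.

Set Implicit Arguments.
Unset Strict Implicit.
Unset Printing Implicit Defensive.

Import Order.TTheory GRing.Theory Num.Theory.
Import numFieldNormedType.Exports.

Local Open Scope ring_scope.

(** Write N for the matrix S^-1 A_(i0) whose Jordan blocks are pairwise
    distinct, and let J be its Jordan form, with blocks of sizes p_j and
    eigenvalues lam_j. S is symmetric, being a combination of symmetric
    matrices, and the commutation of N with S^-1 A_i says that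
    A_i N = A_i S^-1 A_(i0) is symmetric. Passing to a Jordan basis of N turns
    each A_i into a congruent symmetric matrix B_i with B_i J symmetric, that
    is, B_i J = J^T B_i.

    The relation B J = J^T B can be read block by block. The block with indices
    (j, l) vanishes when lam_j and lam_l differ; otherwise it is a Hankel matrix
    whose entry (a, b) vanishes when a + b + 1 < max(p_j, p_l)
    ([intertwiner_neq0]). Scaling the basis vector number a of block j by
    t^(2a + 1 - p_j) multiplies the entry (a, b) by
    t^(2(a + b + 1) - p_j - p_l). At the entries that can be nonzero this
    exponent is at least |p_j - p_l|, and it is 0 only when
    p_j = p_l = a + b + 1. Two distinct blocks with the same eigenvalue have
    different sizes, so as t tends to 0 only the antidiagonals of the diagonal
    blocks survive ([cvg_jordan_scaling]). This scaling has determinant 1.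

    The limits of all the B_i are symmetric and supported on the graph of one
    involution sg of the indices, the reversal of each Jordan block; hence the
    vectors e_x + e_(sg x) and e_x - e_(sg x) diagonalize all of them by
    congruence ([involution_eigenbasis_diag]). The transformations obtained so
    far have a constant nonzero determinant, which one fixed diagonal congruence
    brings to 1 ([twsd_b_of_cvg]). *)

(** * Matrices intertwining a Jordan block with a transposed one *)

(** Indices are shifted by one so that index 0 stands for the missing neighbour
    of the first row or column, where the value is 0: the recurrence
    [intertwiner_shifted_entry] then has no boundary cases. *)
Definition shifted_entry (F : fieldType) (p q : nat) (X : 'M[F]_(p, q))
    (a b : nat) : F :=
  match a, b with
  | a'.+1, b'.+1 =>
      if insub a' is Some i then if insub b' is Some j then X i j else 0 else 0
  | _, _ => 0
  end.

Arguments shifted_entry : simpl never.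

Lemma shifted_entryE (F : fieldType) (p q : nat) (X : 'M[F]_(p, q))
    (i : 'I_p) (j : 'I_q) : shifted_entry X i.+1 j.+1 = X i j.
Proof. by rewrite /shifted_entry !valK. Qed.

Lemma shifted_entry0r (F : fieldType) (p q : nat) (X : 'M[F]_(p, q)) a :
  shifted_entry X a 0 = 0.
Proof. by case: a. Qed.

Lemma mul_mx_jordan_block (F : fieldType) (p q : nat) (X : 'M[F]_(p, q))
    mu i j :
  (X *m jordan_block q mu) i j = X i j * mu + shifted_entry X i.+1 j.
Proof.
rewrite mxE.
under eq_bigr => k _ do rewrite mxE mulrDr mulrnAr -mulrnAr.
rewrite big_split /=; congr (_ + _).
  rewrite (bigD1 j) //= eqxx mulr1n big1 ?addr0 // => k /negbTE->.
  by rewrite mulr0n mulr0.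
case: j => -[|j] /= lt_jq.
  by rewrite big1 // => k _; rewrite mulr0.
pose j' := Ordinal (ltnW lt_jq).
rewrite (bigD1 j') //= eqxx mulr1 big1 ?addr0; last first.
  by move=> k; rewrite -val_eqE /= eqSS => /negbTE->; rewrite mulr0.
by rewrite -(shifted_entryE X i j').
Qed.

Lemma shifted_entry_tr (F : fieldType) (p q : nat) (X : 'M[F]_(p, q)) a b :
  shifted_entry X^T a b = shifted_entry X b a.
Proof.
case: a => [|a]; first by rewrite shifted_entry0r.
case: b => [|b] //; rewrite /shifted_entry.
by case: (insub a) => [i|]; case: (insub b) => [j|] //; rewrite mxE.
Qed.

(** The superdiagonal of the Jordan block on the right shifts columns, the
    transposed one on the left shifts rows. *)
Lemma intertwiner_shifted_entry (F : fieldType) (p q : nat) (lam mu : F)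
    (X : 'M[F]_(p, q)) (a b : nat) :
    X *m jordan_block q mu = (jordan_block p lam)^T *m X ->
    (a < p)%N -> (b < q)%N ->
  (mu - lam) * shifted_entry X a.+1 b.+1 =
    shifted_entry X a b.+1 - shifted_entry X a.+1 b.
Proof.
move=> eqX lt_ap lt_bq.
pose i := Ordinal lt_ap; pose j := Ordinal lt_bq.
have /matrixP/(_ i j) := eqX.
rewrite mul_mx_jordan_block -[_^T *m X]trmxK trmx_mul trmxK [RHS]mxE.
rewrite mul_mx_jordan_block mxE shifted_entry_tr.
rewrite (shifted_entryE X i j : shifted_entry X a.+1 b.+1 = _) /= => eq_ij.
have -> : shifted_entry X a b.+1
          = X i j * mu + shifted_entry X a.+1 b - X i j * lam.
  by rewrite eq_ij; ring.
by ring.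
Qed.

(** For distinct eigenvalues the recurrence expresses every entry through the
    entries above and to the left of it, down to the zero border. *)
Lemma intertwiner_diff_eigenvalue (F : fieldType) (p q : nat) (lam mu : F)
    (X : 'M[F]_(p, q)) :
    X *m jordan_block q mu = (jordan_block p lam)^T *m X ->
  lam != mu -> X = 0.
Proof.
move=> eqX neq; apply/matrixP => i j; rewrite mxE -shifted_entryE.
have dn0 : mu - lam != 0 by rewrite subr_eq0 eq_sym.
suff main a b : (a <= p)%N -> (b <= q)%N -> shifted_entry X a b = 0.
  by rewrite main.
elim: a b => [|a IHa] b // le_ap.
elim: b => [|b IHb] // le_bq.
apply: (mulfI dn0); rewrite mulr0 (intertwiner_shifted_entry eqX) //.
by rewrite IHa ?IHb ?subr0 ?(ltnW le_bq) // ltnW.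
Qed.

(** For equal eigenvalues the recurrence says that moving along an antidiagonal
    does not change the entry. *)
Lemma intertwiner_slide (F : fieldType) (p q : nat) (lam : F)
    (X : 'M[F]_(p, q)) (a b s : nat) :
    X *m jordan_block q lam = (jordan_block p lam)^T *m X ->
    (a + s <= p)%N -> (b + s <= q)%N ->
  shifted_entry X (a + s) b = shifted_entry X a (b + s).
Proof.
move=> eqX; elim: s a => [|s IHs] a; first by rewrite !addn0.
rewrite addnS -addSn => le_ap le_bq; rewrite IHs //; last by lia.
apply/esym/eqP; rewrite -subr_eq0 addnS -(intertwiner_shifted_entry eqX).
- by rewrite subrr mul0r.
- by lia.
- by lia.
Qed.

(** An antidiagonal too short to cross the larger side of the matrix can be
    followed to the zero border. *)
Lemma intertwiner_neq0 (F : fieldType) (p q : nat) (lam mu : F)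
    (X : 'M[F]_(p, q)) (i : 'I_p) (j : 'I_q) :
    X *m jordan_block q mu = (jordan_block p lam)^T *m X ->
    X i j != 0 ->
  lam = mu /\ (maxn p q <= i + j + 1)%N.
Proof.
move=> eqX; have [eq_lm|/(intertwiner_diff_eigenvalue eqX)->] := eqVneq lam mu;
  last by rewrite mxE eqxx.
rewrite -{}eq_lm in eqX *; rewrite -shifted_entryE => nz; split=> //.
have [lt_ip lt_jq] := (ltn_ord i, ltn_ord j).
rewrite leqNgt; apply: contra nz => lt_max; apply/eqP.
have [le_p|lt_p] := leqP (i.+1 + j.+1) p.
  by rewrite -[j.+1]add0n -(intertwiner_slide eqX) // shifted_entry0r.
by rewrite -[i.+1]add0n (intertwiner_slide eqX) //; lia.
Qed.

(** * The reversal of every block *)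

Definition block_rev (r : nat) (p : 'I_r -> nat) (x : 'I_(\sum_k p k)) :
    'I_(\sum_k p k) :=
  tagnat.Rank _ (rev_ord (tagnat.sig2 x)).

Lemma eq_tagnat (r : nat) (p : 'I_r -> nat) (x y : 'I_(\sum_k p k)) :
  (x == y) = (tagnat.sig1 x == tagnat.sig1 y)
             && (tagnat.sig2 x == tagnat.sig2 y :> nat).
Proof. by rewrite -tagnat.eq_Rank !tagnat.sig2K. Qed.

Lemma block_rev_sig1 (r : nat) (p : 'I_r -> nat) (x : 'I_(\sum_k p k)) :
  tagnat.sig1 (block_rev x) = tagnat.sig1 x.
Proof. exact: tagnat.Rank1K. Qed.

Lemma block_rev_sig2 (r : nat) (p : 'I_r -> nat) (x : 'I_(\sum_k p k)) :
  tagnat.sig2 (block_rev x) = (p (tagnat.sig1 x) - (tagnat.sig2 x).+1)%N :> nat.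
Proof. by rewrite /block_rev tagnat.Rank2K. Qed.

Lemma block_revK (r : nat) (p : 'I_r -> nat) :
  involutive (@block_rev r p).
Proof.
move=> x; apply/eqP; rewrite eq_tagnat !block_rev_sig2 !block_rev_sig1 eqxx.
by have := ltn_ord (tagnat.sig2 x); lia.
Qed.

(** This bounds from below the exponent that [jordan_scaling] produces at a
    nonzero entry; the boolean makes the bound strict away from the
    antidiagonals of the diagonal blocks. For distinct blocks with the same
    eigenvalue the strictness comes from max(p_j, p_l) > (p_j + p_l) / 2. *)
Lemma jordan_symmetrizer_neq0 (F : fieldType) (r : nat) (lam : 'I_r -> F)
    (p : 'I_r -> nat) (B : 'M[F]_(\sum_k p k)) (x y : 'I_(\sum_k p k)) :
    (forall k l, k != l -> ~ (lam k = lam l /\ p k = p l)) ->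
    B *m jordan_mx lam p = (jordan_mx lam p)^T *m B ->
    B x y != 0 ->
  (p (tagnat.sig1 x) + p (tagnat.sig1 y)
     + (y != block_rev x) <= (tagnat.sig2 x + tagnat.sig2 y).*2.+2)%N.
Proof.
move=> distinct eqB nzB.
set j := tagnat.sig1 x; set l := tagnat.sig1 y.
have eqX : submxblock B j l *m jordan_block (p l) (lam l)
           = (jordan_block (p j) (lam j))^T *m submxblock B j l.
  move: eqB; rewrite /jordan_mx tr_mxdiag -{1 2}(submxblockK B).
  by rewrite mul_mxblock_mxdiag mul_mxdiag_mxblock => /eq_mxblockP.
have := @intertwiner_neq0 _ _ _ _ _ _ (tagnat.sig2 x) (tagnat.sig2 y) eqX.
rewrite mxE !tagnat.sig2K => /(_ nzB) [eq_lam].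
rewrite eq_tagnat block_rev_sig2 block_rev_sig1 -/j -/l.
have [eq_lj|neq_lj] /= := eqVneq l j.
  have eq_p : p l = p j by rewrite eq_lj.
  have := ltn_ord (tagnat.sig2 x); rewrite -/j; lia.
have neq_p : p j != p l.
  by apply/eqP => eq_p; apply: (distinct j l); rewrite // eq_sym.
lia.
Qed.

(** * The scaling of a Jordan basis *)

(** The weight is t^(2a + 1 - p) at position a of a block of size p, centred so
    that positions exchanged by the reversal have inverse weights; the quotient
    keeps the exponents natural. *)
Definition jordan_scaling (F : fieldType) (r : nat) (p : 'I_r -> nat) (t : F) :
    'rV[F]_(\sum_k p k) :=
  \row_x (t ^+ (tagnat.sig2 x).*2.+1 / t ^+ p (tagnat.sig1 x)).

Lemma jordan_scaling_rev (F : fieldType) (r : nat) (p : 'I_r -> nat) (t : F) x :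
  t != 0 -> jordan_scaling p t 0 x * jordan_scaling p t 0 (block_rev x) = 1.
Proof.
move=> t_neq0; rewrite !mxE block_rev_sig2 block_rev_sig1.
rewrite mulrACA -exprD -invfM -exprD.
have -> : ((tagnat.sig2 x).*2.+1
    + (p (tagnat.sig1 x) - (tagnat.sig2 x).+1)%N.*2.+1
    = p (tagnat.sig1 x) + p (tagnat.sig1 x))%N.
  by have := ltn_ord (tagnat.sig2 x); lia.
by rewrite divff // expf_neq0.
Qed.

(** The weights of x and of its reversal are inverse to each other, so the
    determinant has square 1; it is positive because the weights are. *)
Lemma det_jordan_scaling (R : realFieldType) (r : nat) (p : 'I_r -> nat)
    (t : R) :
  0 < t -> \det (diag_mx (jordan_scaling p t)) = 1.
Proof.
move=> t_gt0; rewrite det_diag; set d := \prod_x _.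
have d_gt0 : 0 < d.
  by apply: prodr_gt0 => x _; rewrite mxE divr_gt0 ?exprn_gt0.
have : d ^+ 2 = 1.
  rewrite expr2 {2}/d (reindex_inj (inv_inj (@block_revK r p))) /=.
  rewrite -big_split /=.
  by apply: big1 => x _; rewrite jordan_scaling_rev ?gt_eqF.
by move=> /eqP; rewrite sqrf_eq1 => /orP[/eqP//|/eqP d1]; lra.
Qed.

Lemma jordan_scaling_entry (F : fieldType) (r : nat) (p : 'I_r -> nat) (t : F)
    (B : 'M[F]_(\sum_k p k)) x y :
  (diag_mx (jordan_scaling p t) *m B *m diag_mx (jordan_scaling p t)) x y
  = t ^+ (tagnat.sig2 x + tagnat.sig2 y).*2.+2
      / t ^+ (p (tagnat.sig1 x) + p (tagnat.sig1 y)) * B x y.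
Proof.
rewrite mul_mx_diag mul_diag_mx !mxE.
have -> : ((tagnat.sig2 x + tagnat.sig2 y).*2.+2 =
    (tagnat.sig2 x).*2.+1 + (tagnat.sig2 y).*2.+1)%N by lia.
by rewrite !exprD invfM; ring.
Qed.

(** Convergence of the entries as plain sequences of reals, because the norm of
    interest is the Frobenius norm. *)
Definition entrywise_cvg (R : realType) (m n : nat) (M : nat -> 'M[R]_(m, n))
    (L : 'M[R]_(m, n)) : Prop :=
  forall i j, ((fun k => M k i j) @ \oo --> (L i j : R))%classic.

(** At a nonzero entry the scaling factor is t^(a - b) with a - b a natural
    number, which is 0 exactly on the antidiagonals of the diagonal blocks. *)
Lemma cvg_jordan_scaling (R : realType) (r : nat) (lam : 'I_r -> R)
    (p : 'I_r -> nat) (B : 'M[R]_(\sum_k p k)) :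
    (forall k l, k != l -> ~ (lam k = lam l /\ p k = p l)) ->
    B *m jordan_mx lam p = (jordan_mx lam p)^T *m B ->
  entrywise_cvg
    (fun n => diag_mx (jordan_scaling p n.+1%:R^-1) *m B
      *m diag_mx (jordan_scaling p n.+1%:R^-1))
    (\matrix_(x, y) (B x y *+ (y == block_rev x))).
Proof.
move=> distinct eqB x y; rewrite mxE.
have [Bxy0|nzB] := eqVneq (B x y) 0.
  rewrite Bxy0 mul0rn (_ : (fun k => _) = fun=> 0); first exact: cvg_cst.
  by apply/funext => n; rewrite jordan_scaling_entry Bxy0 mulr0.
have := jordan_symmetrizer_neq0 distinct eqB nzB.
set b := (p _ + p _)%N; set a := (_.*2.+2)%N => le_ba.
have le_ba' : (b <= a)%N by apply: leq_trans le_ba; rewrite leq_addr.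
rewrite (_ : (fun k => _) =
    fun n : nat => n.+1%:R^-1 ^+ (a - b) * B x y); last first.
  apply/funext => n.
  by rewrite jordan_scaling_entry expfB_cond ?invr_eq0 ?pnatr_eq0.
have [eq_y|neq_y] := eqVneq y (block_rev x).
  (* On the antidiagonal of a diagonal block the exponent is exactly 0. *)
  have -> : (a - b = 0)%N.
    rewrite /a /b eq_y block_rev_sig2 block_rev_sig1.
    by have := ltn_ord (tagnat.sig2 x); lia.
  rewrite (_ : (fun k => _) = fun=> B x y); first exact: cvg_cst.
  by apply/funext => n; rewrite expr0 mul1r.
rewrite neq_y addn1 in le_ba.
rewrite mulr0n -[X in (_ --> X)%classic](mul0r (B x y)).
apply: cvgM; last exact: cvg_cst.
have e_gt0 : (0 < a - b)%N by rewrite subn_gt0.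
have -> : 0 = 0 ^+ (a - b) :> R by rewrite expr0n eqn0Ngt e_gt0.
apply: (@cvg_comp _ _ _ (@harmonic R) (fun u => u ^+ (a - b))).
  exact: cvg_harmonic.
exact: exprn_continuous.
Qed.

(** * Diagonalizing matrices supported on an involution *)

(** Any choice of sign taking opposite values on the two elements of each
    2-cycle, and the value 1 at fixed points, would do. *)
Definition involution_sign (F : fieldType) (n : nat) (sg : 'I_n -> 'I_n) x :
    F :=
  (-1) ^+ (sg x < x)%N.

(** Row x is e_x + s_x e_(sg x), so a 2-cycle contributes the sum and the
    difference of its two unit vectors, and a fixed point contributes 2 e_x. *)
Definition involution_eigenbasis (F : fieldType) (n : nat) (sg : 'I_n -> 'I_n) :
    'M[F]_n :=
  \matrix_(x, y) ((x == y)%:R + involution_sign F sg x * (sg x == y)%:R).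

Lemma involution_sign_opp (F : fieldType) (n : nat) (sg : 'I_n -> 'I_n) x :
    involutive sg -> sg x != x ->
  involution_sign F sg (sg x) = - involution_sign F sg x.
Proof.
move=> sgK; rewrite /involution_sign sgK -val_eqE neq_ltn.
by case: ltngtP => //= _ _; rewrite expr1 ?opprK.
Qed.

Lemma mul_involution_eigenbasis (F : fieldType) (n q : nat) (sg : 'I_n -> 'I_n)
    (M : 'M[F]_(n, q)) x y :
  (involution_eigenbasis F sg *m M) x y
  = M x y + involution_sign F sg x * M (sg x) y.
Proof.
rewrite mxE.
under eq_bigr => z _ do rewrite mxE mulrDl -mulrA.
rewrite big_split /= -mulr_sumr; congr (_ + _ * _).
  rewrite (bigD1 x) //= eqxx mul1r big1 ?addr0 // => z.
  by rewrite eq_sym => /negbTE->; rewrite mul0r.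
rewrite (bigD1 (sg x)) //= eqxx mul1r big1 ?addr0 // => z.
by rewrite eq_sym => /negbTE->; rewrite mul0r.
Qed.

Lemma congr_involution_eigenbasis (F : fieldType) (n : nat) (sg : 'I_n -> 'I_n)
    (M : 'M[F]_n) x y :
  let s := involution_sign F sg in
  (involution_eigenbasis F sg *m M *m (involution_eigenbasis F sg)^T) x y
  = M x y + s x * M (sg x) y + s y * (M x (sg y) + s x * M (sg x) (sg y)).
Proof.
move=> s; rewrite -[_ *m M *m _]trmxK trmx_mul trmxK mxE.
rewrite [LHS]mul_involution_eigenbasis.
by rewrite ![_^T _ _]mxE !mul_involution_eigenbasis.
Qed.

(** Symmetry of B gives the two entries of a 2-cycle the same value c, and on
    the corresponding plane the form 2 c u v is diagonal in the basis formed by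
    the sum and the difference. *)
Lemma involution_eigenbasis_diag (F : fieldType) (n : nat) (sg : 'I_n -> 'I_n)
    (B : 'M[F]_n) :
    involutive sg -> B^T = B ->
  is_diag_mx (involution_eigenbasis F sg
    *m (\matrix_(x, y) (B x y *+ (y == sg x)))
    *m (involution_eigenbasis F sg)^T).
Proof.
move=> sgK symB; apply/is_diag_mxP => x y.
rewrite val_eqE => neq_xy; rewrite congr_involution_eigenbasis !mxE.
rewrite sgK (inj_eq (inv_inj sgK)) [y == x]eq_sym (negbTE neq_xy) !mulr0n.
rewrite -(can2_eq sgK sgK) [sg y == x]eq_sym.
have [eq_x|_] := eqVneq x (sg y); last by rewrite !mulr0n; ring.
have y_sgx : y = sg x by rewrite eq_x sgK.
have sx : involution_sign F sg x = - involution_sign F sg y.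
  by rewrite {1}eq_x involution_sign_opp // -eq_x.
rewrite sx !mulr1n -{1}eq_x -y_sgx -[in B y x]symB mxE.
have sqr : involution_sign F sg y * involution_sign F sg y = 1.
  by rewrite -expr2 /involution_sign sqrr_sign.
by ring : sqr.
Qed.

(** The rows are orthogonal, with squared norm 2 on 2-cycles and 4 at fixed
    points. *)
Lemma det_involution_eigenbasis (R : numFieldType) (n : nat)
    (sg : 'I_n -> 'I_n) :
  involutive sg -> \det (involution_eigenbasis R sg) != 0.
Proof.
move=> sgK; set E := involution_eigenbasis R sg.
have EE : E *m 1%:M *m E^T = diag_mx (\row_x (2 *+ (sg x == x).+1)).
  apply/matrixP => x y; rewrite [LHS]congr_involution_eigenbasis !mxE.
  rewrite (inj_eq (inv_inj sgK)) -[x == sg y](can2_eq sgK sgK).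
  have [<-|neq_xy] := eqVneq x y.
    rewrite /involution_sign; case: eqVneq => [->|_]; rewrite ?ltnn /=.
      by rewrite !mulr1n; ring.
    by rewrite !mulr1n mulr0 !addr0 mulr1 add0r -expr2 sqrr_sign.
  have [sgx|_] := eqVneq (sg x) y; last by rewrite !mulr0n; ring.
  rewrite -sgx involution_sign_opp //; last by rewrite sgx eq_sym.
  by rewrite !mulr0n; ring.
rewrite -sqrf_eq0 expr2 -{2}det_tr -det_mulmx -[E in E *m _]mulmx1 EE det_diag.
apply/prodf_neq0 => x _; rewrite mxE.
by rewrite mulrn_eq0 pnatr_eq0.
Qed.

(** * From convergence to the approximate diagonalization *)

Lemma entrywise_cvg_mulmx (R : realType) (m n p q : nat) (P : 'M[R]_(m, n))
    (Q : 'M[R]_(p, q)) (M : nat -> 'M[R]_(n, p)) (L : 'M[R]_(n, p)) :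
    entrywise_cvg M L ->
  entrywise_cvg (fun k => P *m M k *m Q) (P *m L *m Q).
Proof.
move=> cvgM i j.
rewrite mxE (_ : (fun k => _) =
  fun k => \sum_a (\sum_b P i b * M k b a) * Q a j); last first.
  by apply/funext => k; rewrite mxE; apply: eq_bigr => a _; rewrite mxE.
apply: cvg_big => [|a _]; first exact: add_continuous.
apply: cvgMr_tmp; rewrite mxE.
apply: cvg_big => [|b _]; first exact: add_continuous.
by apply: cvgMl_tmp; exact: cvgM.
Qed.

Lemma frobenius_norm_sqr (R : realType) (m n : nat) (M : 'M[R]_(m, n)) :
  frobenius_norm M ^+ 2 = \sum_i \sum_j M i j ^+ 2.
Proof.
rewrite sqr_sqrtr //; apply: sumr_ge0 => i _; apply: sumr_ge0 => j _.
exact: sqr_ge0.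
Qed.

Lemma cvg_frobenius_norm (R : realType) (m n : nat) (M : nat -> 'M[R]_(m, n))
    (L : 'M[R]_(m, n)) :
    entrywise_cvg M L ->
  ((fun k => frobenius_norm (M k - L) ^+ 2) @ \oo --> (0 : R))%classic.
Proof.
move=> cvgM.
rewrite (_ : (fun k => _) =
    fun k => \sum_i \sum_j (M k i j - L i j) ^+ 2); last first.
  apply/funext => k; rewrite frobenius_norm_sqr.
  by apply: eq_bigr => i _; apply: eq_bigr => j _; rewrite !mxE.
have sum0 : 0 = \sum_(i < m) \sum_(j < n) (L i j - L i j) ^+ 2.
  rewrite big1 // => i _; rewrite big1 // => j _.
  by rewrite subrr expr0n.
rewrite [X in (_ --> X)%classic]sum0.
apply: cvg_big => [|i _]; first exact: add_continuous.
apply: cvg_big => [|j _]; first exact: add_continuous.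
have cvg_ij : ((fun k => M k i j - L i j) @ \oo --> L i j - L i j)%classic.
  by apply: cvgB; [exact: cvgM|exact: cvg_cst].
exact: normed_module.cvgM.
Qed.

(** The empty matrix has determinant 1, whence the condition for n = 0. *)
Lemma exists_diag_det (F : fieldType) (n : nat) (g : F) :
  (n = 0%N -> g = 1) -> exists w : 'rV[F]_n, \det (diag_mx w) = g.
Proof.
case: n => [g1|n _]; first by exists 0; rewrite g1 // det_mx00.
exists (\row_x (if x == ord0 then g else 1)).
rewrite det_diag big_ord_recl mxE eqxx big1 ?mulr1 // => i _.
by rewrite mxE.
Qed.

(** Congruence by a diagonal W preserves diagonal matrices, so a constant
    determinant can be normalized; the diagonal targets W D_i W do not depend
    on k, hence are bounded. *)
Lemma twsd_b_of_cvg (R : realType) (m L : nat) (A : 'I_L -> 'M[R]_m)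
    (P : nat -> 'M[R]_m) (D : 'I_L -> 'M[R]_m) (g : R) :
    g != 0 -> (forall k, \det (P k) = g) ->
    (forall i, is_diag_mx (D i)) ->
    (forall i, entrywise_cvg (fun k => P k *m A i *m (P k)^T) (D i)) ->
  twsd_b A.
Proof.
move=> g_neq0 detP diagD cvgP.
have [w det_w] : exists w : 'rV[R]_m, \det (diag_mx w) = g^-1.
  apply: exists_diag_det => m0; move: (detP 0%N); rewrite -{}(detP 0%N).
  by move: (P 0%N); rewrite m0 => ?; rewrite det_mx00 invr1.
pose W := diag_mx w.
exists (fun k => W *m P k), (fun _ i => W *m D i *m W); split.
- by move=> k; rewrite det_mulmx det_w detP mulVf.
- move=> _ i; apply/is_diag_mxP => x y neq_xy.
  rewrite mul_mx_diag mul_diag_mx !mxE.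
  by move/is_diag_mxP: (diagD i) => ->; rewrite // mulr0 mul0r.
- have sum0 : 0 = \sum_(i < L) 0 :> R by rewrite big1_eq.
  rewrite [X in (_ --> X)%classic]sum0.
  apply: cvg_big => [|i _]; first exact: add_continuous.
  apply: cvg_frobenius_norm => x y.
  rewrite (_ : (fun k => _)
    = fun k => (W *m (P k *m A i *m (P k)^T) *m W) x y); last first.
    by apply/funext => k; rewrite trmx_mul tr_diag_mx !mulmxA.
  exact: entrywise_cvg_mulmx.
- exists (\sum_i frobenius_norm (W *m D i *m W)) => _ i.
  rewrite (bigD1 i) //= lerDl; apply: sumr_ge0 => j _; exact: sqrtr_ge0.
Qed.

Lemma span_symmetric (F : fieldType) (m L : nat) (A : 'I_L -> 'M[F]_m)
    (S : 'M[F]_m) :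
    (forall i, (A i)^T = A i) -> S \in <<[seq A i | i : 'I_L]>>%VS ->
  S^T = S.
Proof.
move=> symA /(@coord_span _ _ _ (in_tuple _)) ->.
rewrite linear_sum; apply: eq_bigr => i _; rewrite linearZ /=; congr (_ *: _).
have : [seq A i | i : 'I_L]`_i \in [seq A i | i : 'I_L] by rewrite mem_nth.
by case/mapP => k _ ->; exact: symA.
Qed.

(** For symmetric A, B and S this says that A S^-1 B is symmetric, which is the
    form in which commutation enters the proof. *)
Lemma bracket_eq0 (F : fieldType) (m : nat) (S A B : 'M[F]_m) :
    S \in unitmx -> bracket S A B = 0 ->
  A *m (invmx S *m B) = B *m (invmx S *m A).
Proof.
move=> S_unit /eqP; rewrite subr_eq0 -!mulmxA => /eqP/(congr1 (mulmx S)).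
by rewrite !mulKVmx.
Qed.

(** The transformations are E T_k V^T: V passes to the Jordan basis of N, T_k
    scales it with t = 1 / (k + 1), and E diagonalizes the limit. *)
Lemma twsd_b_of_jordan (R : realType) (r L : nat) (lam : 'I_r -> R)
    (p : 'I_r -> nat) (A : 'I_L -> 'M[R]_(\sum_k p k))
    (N Q : 'M[R]_(\sum_k p k)) :
    (forall k l, k != l -> ~ (lam k = lam l /\ p k = p l)) ->
    Q \in unitmx -> Q *m N = jordan_mx lam p *m Q ->
    (forall i, (A i)^T = A i) -> (forall i, (A i *m N)^T = A i *m N) ->
  twsd_b A.
Proof.
move=> distinct Q_unit QN A_sym AN_sym.
pose V := invmx Q; pose B i := V^T *m A i *m V.
pose sg := @block_rev r p; have sgK : involutive sg := @block_revK r p.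
pose E := involution_eigenbasis R sg.
pose T k := diag_mx (jordan_scaling p (k.+1%:R^-1 : R)).
have congr_sym (M : 'M[R]_(\sum_k p k)) :
  M^T = M -> (V^T *m M *m V)^T = V^T *m M *m V.
  by move=> M_sym; rewrite !trmx_mul trmxK M_sym mulmxA.
have B_sym i : (B i)^T = B i by exact: congr_sym.
have VJ : V *m jordan_mx lam p = N *m V.
  apply: (canRL (mulmxK Q_unit)).
  by rewrite -mulmxA -QN mulKmx.
(* The relation B J = J^T B just says that B J = V^T (A N) V is symmetric. *)
have BJ i : B i *m jordan_mx lam p = (jordan_mx lam p)^T *m B i.
  rewrite -{2}(B_sym i) -trmx_mul /B -mulmxA VJ mulmxA -[_ *m A i *m N]mulmxA.
  by rewrite congr_sym.
refine (@twsd_b_of_cvg _ _ _ _ (fun k => E *m T k *m V^T)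
  (fun i => E *m (\matrix_(x, y) (B i x y *+ (y == sg x))) *m E^T)
  (\det E * \det V) _ _ _ _).
- rewrite mulf_neq0 ?det_involution_eigenbasis // -unitfE.
  by rewrite -[_ \is a _]/(V \in unitmx) unitmx_inv.
- by move=> k; rewrite !det_mulmx det_tr det_jordan_scaling ?mulr1.
- by move=> i; exact: involution_eigenbasis_diag.
- move=> i x y.
  rewrite (_ : (fun k => _) = fun k => (E *m (T k *m B i *m T k) *m E^T) x y).
    by apply: entrywise_cvg_mulmx; exact: cvg_jordan_scaling distinct (BJ i).
  by apply/funext => k; rewrite /B !trmx_mul trmxK tr_diag_mx !mulmxA.
Qed.

Theorem theorem3p13 (R : realType) (m L : nat) (A : 'I_L -> 'M[R]_m)
    (S : 'M[R]_m)
    (A_sym : forall i, (A i)^T = A i)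
    (S_span : S \in <<[seq A i | i : 'I_L]>>%VS)
    (S_unit : S \in unitmx)
    (real_eig : forall i, only_real_eigenvalues (invmx S *m A i))
    (commuting : forall i j, i != j -> bracket S (A i) (A j) = 0)
    (jordan_distinct : exists i, jordan_blocks_distinct (invmx S *m A i)) :
  twsd_b A.
Proof.
have S_sym := span_symmetric A_sym S_span.
have [i0 [r [lam [p [[_ [def_m sim]] distinct]]]]] := jordan_distinct.
(* The cast of the Jordan form disappears once m is replaced by the sum of the
   block sizes. *)
case: m / def_m in A S A_sym S_unit commuting S_sym sim
  {S_span real_eig jordan_distinct} *.
rewrite castmx_id in sim; case: sim => Q Q_unit /(similarP Q_unit) QN.
apply: (twsd_b_of_jordan distinct Q_unit QN A_sym) => i.
rewrite !trmx_mul trmx_inv S_sym !A_sym -mulmxA.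
have [->//|neq_i] := eqVneq i0 i.
exact: bracket_eq0 S_unit (commuting _ _ neq_i).
Qed.
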